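(* Fix $\ell>0$, $\sigma>0$, $\epsilon>0$, $\Delta>0$ and a sequence $\{\gamma_t\}_{t=0}^\infty$ of positive reals with $\gamma_t\le\gamma_{\max}$ for all $t$, such that $$\epsilon^2<\min\left\{\sigma^2,\ 2\ell\Delta,\ \frac{2\Delta(\sigma-\epsilon)}{\gamma_{\max}}\right\}.$$ Then there exist an $\ell$-smooth convex function $f$, an initial point $x_0$ with $f(x_0)-\min_x f(x)\le\Delta$, and a stochastic gradient oracle $g(x;\xi)$ for $f$ with zero-mean noise of variance at most $\sigma^2$, such that the iterates of NSGD, $$x_{t+1}=x_t-\frac{\gamma_t}{\|g(x_t;\xi_t)\|}\,g(x_t;\xi_t),$$ satisfy $\mathbb{E}\|\nabla f(x_t)\|\ge\epsilon$ for all $t\ge0$.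
   Context: A function $f$ on a Euclidean space is $\ell$-smooth if it is differentiable with $\|\nabla f(x_1)-\nabla f(x_2)\|\le\ell\|x_1-x_2\|$ for all $x_1,x_2$. Zero-mean noise of variance at most $\sigma^2$ means: for every $x$, $\mathbb{E}_\xi[g(x;\xi)]=\nabla f(x)$ and $\mathbb{E}_\xi\|g(x;\xi)-\nabla f(x)\|^2\le\sigma^2$. The samples $\xi_0,\xi_1,\dots$ are drawn afresh at each iteration (independently of the past). If the stochastic gradient is zero, the update step is taken to be zero. *)

(* Defs.v *)
From HB Require Import structures.
From mathcomp Require Import all_boot all_order all_algebra.
From mathcomp Require Import all_classical all_reals all_analysis.
Set Implicit Arguments.
Unset Strict Implicit.
Unset Printing Implicit Defensive.
Import Order.TTheory GRing.Theory Num.Theory.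
Import numFieldNormedType.Exports.
Local Open Scope classical_set_scope.
Local Open Scope ring_scope.

(* The library norm `|v| on 'rV[R]_n is the sup norm; the differentiability
   notion it induces is the same, but lengths are measured with this one. *)
Definition enorm (R : realType) (n : nat) (v : 'rV[R]_n) : R :=
  Num.sqrt (\sum_(i < n) v ord0 i ^+ 2).

Definition gradient (R : realType) (n : nat) (f : 'rV[R]_n -> R)
    (x : 'rV[R]_n) : 'rV[R]_n :=
  \row_(i < n) 'D_(delta_mx ord0 i) f x.

Definition smooth (R : realType) (n : nat) (l : R) (f : 'rV[R]_n -> R) : Prop :=
  (forall x, differentiable f x) /\
  (forall x1 x2,
     enorm (gradient f x1 - gradient f x2) <= l * enorm (x1 - x2)).

(* The minimum is attained. *)
Definition suboptimality_le (R : realType) (n : nat) (f : 'rV[R]_n -> R)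
    (x0 : 'rV[R]_n) (Delta : R) : Prop :=
  exists2 xmin, (forall x, f xmin <= f x) & f x0 - f xmin <= Delta.

(* R^n with its Borel sigma-algebra. *)
Definition borel_rV (R : realType) (n : nat) :=
  g_sigma_algebraType (@open 'rV[R]_n).

(* g is a stochastic gradient oracle for f, fed with samples of law D, with
   zero-mean noise of variance at most sigma ^+ 2. Joint measurability of g makes
   every iterate of an algorithm calling g a random variable. *)
Definition stochastic_gradient (R : realType) (n : nat) (f : 'rV[R]_n -> R)
    (d : measure_display) (Xi : measurableType d) (D : probability Xi R)
    (g : 'rV[R]_n -> Xi -> 'rV[R]_n) (sigma : R) : Prop :=
  [/\ measurable_fun [set: borel_rV R n * Xi]
        (fun p => g p.1 p.2 : borel_rV R n),
      forall x i, D.-integrable [set: Xi] (fun z => (g x z ord0 i)%:E),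
      forall x i, ('E_D[fun z => g x z ord0 i] = (gradient f x ord0 i)%:E)%E &
      forall x, ('E_D[fun z => (enorm (g x z - gradient f x) ^+ 2)%R]
                 <= (sigma ^+ 2)%:E)%E].

Definition iid (R : realType) (d d' : measure_display)
    (Omega : measurableType d) (P : probability Omega R)
    (Xi : measurableType d') (D : probability Xi R)
    (xi : nat -> {RV P >-> Xi}) : Prop :=
  (forall t A, measurable A -> distribution P (xi t) A = D A) /\
  (forall (s : seq nat) (A : nat -> set Xi), uniq s ->
     (forall t, measurable (A t)) ->
     P (\bigcap_(t in [set` s]) (xi t @^-1` A t)) =
     (\prod_(t <- s) P (xi t @^-1` A t))%E).

(* The iterates along one realization z of the samples. When the stochastic
   gradient is 0 the step is (gamma t / 0) *: 0 = 0, the intended convention. *)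
Fixpoint nsgd (R : realType) (n : nat) (Xi : Type) (gamma : nat -> R)
    (g : 'rV[R]_n -> Xi -> 'rV[R]_n) (x0 : 'rV[R]_n) (z : nat -> Xi)
    (t : nat) : 'rV[R]_n :=
  if t is s.+1 then
    let x := nsgd gamma g x0 z s in
    x - (gamma s / enorm (g x (z s))) *: g x (z s)
  else x0.

(* Main.v *)
Require Import Defs.
From HB Require Import structures.
From mathcomp Require Import all_boot all_order all_algebra.
From mathcomp Require Import all_classical all_reals all_analysis.
From mathcomp Require Import measurable_realfun ring lra.
Set Implicit Arguments.
Unset Strict Implicit.
Unset Printing Implicit Defensive.
Import Order.TTheory GRing.Theory Num.Theory.
Import numFieldNormedType.Exports.
Local Open Scope classical_set_scope.
Local Open Scope ring_scope.

(* On the line, let f(x) = h x^2 / 2 with h = eps^2 / (2 Delta), started where the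
   slope is eps. At a point of slope a, put v = |a| + sigma - eps and let the oracle
   point towards the minimizer only with probability p = v^2 / (v^2 + sigma^2),
   reversing its sign otherwise; two values of variance sigma^2 and mean a achieve
   this. Since 2 v sigma <= v^2 + sigma^2, the drift of |a| satisfies
   1 - 2 p >= (eps - |a|) / sigma. This bound is linear in |a|, hence
     E|a_(t+1)| >= E|a_t| + (h gamma_t / sigma) (eps - E|a_t|),
   and h gamma_t <= sigma keeps E|a_t| >= eps. *)

(** * The uniform law on the unit interval and two-valued random variables *)

Lemma uniform_prob01_le {R : realType} (p : R) : 0 <= p <= 1 ->
  uniform_prob (@ltr01 R) [set z | z <= p] = p%:E.
Proof.
move=> /andP[p0 p1]; rewrite /uniform_prob integral_uniform_pdf.
have -> : [set z : R | z <= p] `&` `[0, 1]%classic = `[0, p]%classic.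
  apply/seteqP; split=> z /=; rewrite !in_itv/=; first by move=> [-> /andP[->]].
  by move=> /andP[-> zp]; rewrite zp (le_trans zp).
under eq_integral => z.
  rewrite inE/= in_itv/= => /andP[z0 zp].
  rewrite /uniform_pdf z0 (le_trans zp p1)/= subr0 invr1.
  over.
rewrite integral_cst//= mul1e lebesgue_measure_itv/= lte_fin.
case: ltP => [_|p0']; first by rewrite oppr0 adde0.
by congr EFin; apply/le_anti; rewrite p0 p0'.
Qed.

Section two_valued.
Context d (T : measurableType d) (R : realType) (D : probability T R).
Variables (c : T -> bool) (mc : measurable_fun [set: T] c) (p a b : R).
Hypothesis Dc : D (c @^-1` [set true]) = p%:E.

Lemma integrable_two_valued :
  D.-integrable [set: T] (fun z => (if c z then a else b)%:E).
Proof.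
apply: measurable_bounded_integrable => //.
- by rewrite (le_lt_trans (probability_le1 _ _)) ?ltry.
- exact: measurable_fun_ifT.
exists (Num.max `|a| `|b|); split; first exact: num_real.
by move=> M ltM z _ /=; apply: le_trans (ltW ltM); case: ifP; rewrite le_max lexx ?orbT.
Qed.

Lemma expectation_two_valued :
  ('E_D[fun z => if c z then a else b] = (p * a + (1 - p) * b)%:E)%E.
Proof.
have mC e : measurable (c @^-1` [set e]) by rewrite -[X in measurable X]setTI; exact: mc.
have cC : c @^-1` [set false] = ~` (c @^-1` [set true]).
  by apply/seteqP; split=> z /=; case: (c z).
rewrite unlock -(setUv (c @^-1` [set true])) integral_setU//=; last 3 first.
- exact: measurableC.
- by rewrite setUv; apply/measurable_EFinP; exact: measurable_fun_ifT.
- by rewrite disj_set2E setICr.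
rewrite (eq_integral (cst a%:E)); last by move=> z; rewrite inE/= => ->.
rewrite [X in (_ + X)%E](eq_integral (cst b%:E)); last first.
  by move=> z; rewrite inE/= => /negP/negbTE ->.
rewrite !integral_cst//; last exact: measurableC.
have := probability_setC D (mC true); rewrite /setC/= => ->.
by rewrite Dc -EFinB -!EFinM -EFinD; congr (_%:E); ring.
Qed.

End two_valued.

(** * Independence of past events from later samples *)

(* Independence from all samples of index at least [n]; intersecting with an
   event of the [n]-th sample preserves it, so no filtration is needed. *)
Definition indep_future {R : realType} {d d' : measure_display}
    {Omega : measurableType d} (P : probability Omega R)
    {Xi : measurableType d'} (xi : nat -> {RV P >-> Xi}) (n : nat)
    (B : set Omega) : Prop :=
  forall (s : seq nat) (A : nat -> set Xi), uniq s -> all (leq n) s ->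
    (forall t, measurable (A t)) ->
    P (B `&` \bigcap_(t in [set` s]) (xi t @^-1` A t)) =
    (P B * \prod_(t <- s) P (xi t @^-1` A t))%E.

Section indep_future.
Context {R : realType} {d d' : measure_display} {Omega : measurableType d}
  {P : probability Omega R} {Xi : measurableType d'} {D : probability Xi R}
  {xi : nat -> {RV P >-> Xi}}.

Lemma iid_indep_future : iid D xi -> indep_future xi 0 [set: Omega].
Proof.
by move=> [_ ind] s A us _ mA; rewrite setTI probability_setT mul1e ind.
Qed.

Lemma indep_future_setI n B C : indep_future xi n B -> measurable C ->
  P (B `&` xi n @^-1` C) = (P B * P (xi n @^-1` C))%E.
Proof.
move=> /(_ [:: n] (fun=> C) isT) + mC => /(_ _ (fun=> mC)).
rewrite /= leqnn big_seq1 => /(_ isT) <-; congr (P (_ `&` _)).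
apply/seteqP; split=> w /=; first by move=> Cw t /=; rewrite inE => /eqP ->.
by apply; rewrite /= inE.
Qed.

(** Prepending [n] to the index list, with [C] as its event, turns the new constraint on the [n]-th
    sample into one more factor of the product already known for [B]. *)
Lemma indep_futureS n B C : indep_future xi n B -> measurable C ->
  indep_future xi n.+1 (B `&` xi n @^-1` C).
Proof.
move=> iB mC s A us sn mA; rewrite (indep_future_setI iB mC) -muleA.
have ns : n \notin s by apply/negP => /(allP sn); rewrite ltnn.
have sub t : t \in s -> (t == n) = false.
  by move=> ts; apply/eqP => tn; rewrite -tn ts in ns.
pose A' t := if t == n then C else A t.
have := iB (n :: s) A'; rewrite /= ns us leqnn big_cons /= => /(_ isT).
have -> : all (leq n) s by apply: sub_all sn => t /ltnW.
rewrite /A' eqxx => /(_ isT); have mA' t : measurable (A' t) by rewrite /A'; case: ifP.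
move=> /(_ mA'); rewrite [X in (_ * (_ * X))%E](_ : _ = \prod_(t <- s) P (xi t @^-1` A t))%E.
  move=> <-; rewrite -setIA; congr (P (_ `&` _)).
  apply/seteqP; split=> w /=.
    move=> [Cw Aw] t /=; rewrite inE => /predU1P[->|ts]; first by rewrite eqxx.
    by rewrite sub//; exact: Aw.
  move=> h; split; first by have := h n; rewrite /= eqxx inE eqxx; apply.
  by move=> t /= ts; have := h t; rewrite /= inE ts orbT sub//; apply.
by rewrite big_seq [RHS]big_seq; apply: eq_bigr => t ts; rewrite sub.
Qed.

End indep_future.

(** * Backward induction for NSGD with a two-valued oracle *)

Section nsgd_lower_bound.
Context {R : realType} {n : nat} {d d' : measure_display}
  {Omega : measurableType d} {P : probability Omega R}
  {Xi : measurableType d'} {D : probability Xi R}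
  {xi : nat -> {RV P >-> Xi}} (xi_iid : iid D xi).
Variables (gamma : nat -> R) (g : 'rV[R]_n -> Xi -> 'rV[R]_n).

Let step s x (v : 'rV[R]_n) : 'rV[R]_n := x - (gamma s / enorm v) *: v.

(** [nsgd] recurses on its last step, whereas conditioning on the first sample needs the first step
    peeled off, hence the time shift by [s]. *)
Lemma nsgd_recl s x z k :
  nsgd (fun i => gamma (s + i)%N) g x (fun i => z (s + i)%N) k.+1 =
  nsgd (fun i => gamma (s.+1 + i)%N) g (step s x (g x (z s)))
    (fun i => z (s.+1 + i)%N) k.
Proof.
elim: k => [|k IH]; first by rewrite /= !addn0.
rewrite [LHS]/= -/(nsgd _ _ _ _ k.+1) IH /=.
by rewrite !addnS !addSn.
Qed.

Variables (c : 'rV[R]_n -> Xi -> bool) (g1 g2 : 'rV[R]_n -> 'rV[R]_n).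
Variables (p : 'rV[R]_n -> R) (F : 'rV[R]_n -> R).
Hypothesis mc : forall x, measurable_fun [set: Xi] (c x).
Hypothesis gE : forall x z, g x z = if c x z then g1 x else g2 x.
Hypothesis Dc : forall x, D (c x @^-1` [set true]) = (p x)%:E.
Hypothesis F0 : forall x, 0 <= F x.

Let nsgd_sample_recl s x w k :
  nsgd (fun i => gamma (s + i)%N) g x (fun i => xi (s + i)%N w) k.+1 =
  nsgd (fun i => gamma (s.+1 + i)%N) g
    (step s x (if c x (xi s w) then g1 x else g2 x))
    (fun i => xi (s.+1 + i)%N w) k.
Proof. by rewrite -gE; exact: (nsgd_recl s x (xi ^~ w)). Qed.

(** From a fixed [x], the first sample only selects one of two fixed successors, so the function is
    an [if] between two functions that are measurable by induction. *)
Lemma measurable_nsgd_two_valued s x k : measurable_fun [set: Omega]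
  (fun w => F (nsgd (fun i => gamma (s + i)%N) g x
                 (fun i => xi (s + i)%N w) k)).
Proof.
elim: k s x => [|k IH] s x; first by rewrite /=; exact: measurable_cst.
under eq_fun => w.
  rewrite nsgd_sample_recl (fun_if (step s x)).
  rewrite (fun_if (fun y => F (nsgd _ g y _ k))).
  over.
by apply: measurable_fun_ifT => //; apply: measurableT_comp.
Qed.

(* Conditioning on the first sample leaves two deterministic successors, so a
   bound by potentials propagates backwards in time. *)
Lemma nsgd_lower_bound (V : nat -> 'rV[R]_n -> R) T x0 :
  (forall x, V T x <= F x) ->
  (forall s x, (s < T)%N ->
     V s x <= p x * V s.+1 (step s x (g1 x)) + (1 - p x) * V s.+1 (step s x (g2 x))) ->
  ((V 0%N x0)%:E <= 'E_P[fun w => F (nsgd gamma g x0 (xi ^~ w) T)])%E.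
Proof.
move=> VT Vs.
(* The run restarts at time [s] from a fixed [x], with [k] steps left. Integrating over an event [B]
   independent of the samples still to come replaces a conditional expectation. *)
suff H k : forall s x B, (s + k = T)%N -> measurable B -> indep_future xi s B ->
    ((V s x)%:E * P B <= \int[P]_(w in B)
       (F (nsgd (fun i => gamma (s + i)%N) g x (fun i => xi (s + i)%N w) k))%:E)%E.
  have := H T 0%N x0 setT erefl measurableT (iid_indep_future xi_iid).
  by rewrite probability_setT mule1 unlock.
elim: k => [|k IH] s x B sT mB iB.
  rewrite addn0 in sT; rewrite /= integral_cst//; apply: lee_wpmul2r => //.
  by rewrite lee_fin sT.
have mC e : measurable (c x @^-1` [set e]).
  by rewrite -[X in measurable X]setTI; exact: mc.
have mxC e : measurable (xi s @^-1` (c x @^-1` [set e])).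
  by rewrite -[X in measurable X]setTI; exact: measurable_funPT.
pose B' e := B `&` xi s @^-1` (c x @^-1` [set e]).
have mB' e : measurable (B' e) by exact: measurableI.
have BE : B = B' true `|` B' false.
  apply/seteqP; split=> w; last by move=> [] [].
  by move=> Bw; case E : (c x (xi s w)); [left|right].
have PB : P B = (fine (P B))%:E by rewrite fineK ?fin_num_measure.
have PBt : P (B' true) = (fine (P B) * p x)%:E.
  rewrite (indep_future_setI iB (mC true)).
  by rewrite EFinM -PB -Dc -(xi_iid.1 s _ (mC true)).
have PBf : P (B' false) = (fine (P B) * (1 - p x))%:E.
  rewrite (indep_future_setI iB (mC false)) EFinM -PB; congr (_ * _)%E.
  have -> : P (xi s @^-1` (c x @^-1` [set false])) = D (c x @^-1` [set false]).
    by rewrite -(xi_iid.1 s _ (mC false)).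
  rewrite (_ : c x @^-1` [set false] = ~` (c x @^-1` [set true])).
    by rewrite probability_setC// Dc.
  by apply/seteqP; split=> z /=; case: (c x z).
have sltT : (s < T)%N by rewrite -sT addnS ltnS leq_addr.
have sT' : (s.+1 + k = T)%N by rewrite addSnnS.
rewrite [in leRHS]BE ge0_integral_setU//; last 3 first.
- apply/measurable_EFinP/measurable_funTS.
  exact: (measurable_nsgd_two_valued s x k.+1).
- by move=> w _; rewrite lee_fin.
- rewrite disj_set2E; apply/eqP/seteqP; split=> w //=.
  by move=> [[_ /= cw] [_ /=]]; rewrite cw.
(* The one-step inequality for [V], scaled by [P B], gives the first half; the induction hypothesis
   on each of the two branches gives the second. *)
apply: (@le_trans _ _ ((V s.+1 (step s x (g1 x)))%:E * P (B' true) +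
                       (V s.+1 (step s x (g2 x)))%:E * P (B' false))%E).
  rewrite PBt PBf PB -!EFinM -EFinD lee_fin.
  have := ler_wpM2r (fine_ge0 (measure_ge0 P B)) (Vs s x sltT).
  by move=> /le_trans; apply; rewrite le_eqVlt; apply/orP; left; apply/eqP; ring.
apply: leeD.
- apply: le_trans (IH _ _ _ sT' (mB' true) (indep_futureS iB (mC true))) _.
  rewrite le_eqVlt; apply/orP; left; apply/eqP; apply: eq_integral => w.
  rewrite inE => -[_ cw]; have {}cw : c x (xi s w) = true by [].
  by rewrite nsgd_sample_recl cw.
- apply: le_trans (IH _ _ _ sT' (mB' false) (indep_futureS iB (mC false))) _.
  rewrite le_eqVlt; apply/orP; left; apply/eqP; apply: eq_integral => w.
  rewrite inE => -[_ cw]; have {}cw : c x (xi s w) = false by [].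
  by rewrite nsgd_sample_recl cw.
Qed.

End nsgd_lower_bound.

(** * The quadratic objective on the line *)

Definition quad {R : realType} (h : R) (x : 'rV[R]_1) : R :=
  h / 2 * x ord0 ord0 ^+ 2.

Section quad.
Context {R : realType}.
Implicit Types (h l : R) (x v : 'rV[R]_1).

Lemma enorm_rV1 v : enorm v = `|v ord0 ord0|.
Proof. by rewrite /enorm big_ord1 sqrtr_sqr. Qed.

Let quadE h : quad h = (h / 2) \*: ((fun y : 'rV[R]_1 => y ord0 ord0 : R) ^+ 2).
Proof. by []. Qed.

Lemma is_derive_quad h x v :
  is_derive x v (quad h) (h * x ord0 ord0 * v ord0 ord0).
Proof.
have dc : is_derive x v (fun y : 'rV[R]_1 => y ord0 ord0 : R) (v ord0 ord0).
  apply: DeriveDef; first exact/diff_derivable/differentiable_coord.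
  (* The derivative of a coordinate is read off as an entry of the derivative of the identity. *)
  have := derive_mx (@derivable_id _ _ x v); rewrite derive_id.
  by move=> /matrixP/(_ ord0 ord0); rewrite mxE.
rewrite quadE.
by apply: is_derive_eq; rewrite /GRing.scale/= expr1; field.
Qed.

Lemma gradient_quad h x : gradient (quad h) x = h *: x.
Proof.
apply/rowP => i; rewrite !mxE (ord1 i).
by rewrite (@derive_val _ _ _ _ _ _ _ (is_derive_quad h x _)) mxE !eqxx mulr1.
Qed.

Lemma smooth_quad h l : 0 <= h -> h <= l -> smooth l (quad h).
Proof.
move=> h0 hl; split=> [x|x1 x2].
  rewrite quadE; apply/differentiableZ/differentiableX.
  exact: differentiable_coord.
rewrite !gradient_quad -scalerBr !enorm_rV1 mxE normrM (ger0_norm h0).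
exact: ler_wpM2r.
Qed.

Lemma convex_quad h : 0 <= h ->
  convex_function [set: convex_lmodType 'rV[R]_1] (quad h).
Proof.
move=> h0 t x y _ _.
have t0 : 0 <= t%:inum by [].
have t1 : t%:inum <= 1 by [].
rewrite /quad /conv/= /conv/= !mxE.
set s := t%:inum in t0 t1 *; set a : R := x ord0 ord0; set b : R := y ord0 ord0.
change (h / 2 * (s * a + (1 - s) * b) ^+ 2 <=
  s * (h / 2 * a ^+ 2) + (1 - s) * (h / 2 * b ^+ 2)).
rewrite -subr_ge0 [leRHS](_ : _ = h / 2 * (s * (1 - s) * (a - b) ^+ 2)); last by ring.
by rewrite mulrA mulr_ge0 ?sqr_ge0// !mulr_ge0 ?invr_ge0 ?subr_ge0.
Qed.

End quad.

(** * Borel measurability of the identification of ['rV[R]_1] with [R] *)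

Section borel_rV1.
Context {R : realType}.

Lemma measurable_coord_rV1 :
  measurable_fun [set: borel_rV R 1] 
    (fun x : borel_rV R 1 => (x : 'rV[R]_1) ord0 ord0 : R).
Proof.
apply: (measurability _ (RGenOpens.measurableE R)) => _ [_ [a [b ->]] <-].
rewrite setTI; apply: sub_sigma_algebra.
have /continuousP := @coord_continuous R 1 1 ord0 ord0; apply.
exact: interval_open.
Qed.

Lemma continuous_const_mx m n : continuous (fun a : R => const_mx a : 'M[R]_(m, n)).
Proof.
move=> a U /nbhs_ballP[e e0 eU]; apply/nbhs_ballP; exists e => // b ab.
by apply: eU; split=> // i j; rewrite !mxE.
Qed.

Lemma measurable_const_rV1 :
  measurable_fun [set: R] (fun a : R => const_mx a : borel_rV R 1).
Proof.
apply: measurability; first by reflexivity.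
move=> _ [U oU <-]; rewrite setTI; apply: open_measurable.
by have /continuousP := @continuous_const_mx 1 1; apply.
Qed.
End borel_rV1.

(** * The two-valued oracle: mean, variance, directions and measurability *)

Section oracle.
Context {R : realType}.
Variables (h sigma eps : R).
Hypotheses (sigma_gt0 : 0 < sigma) (eps_lt_sigma : eps < sigma).
Implicit Types (a : R) (x : 'rV[R]_1).

(* [sgn 0 = 1], so that the oracle never returns [0]. *)
Definition sgn a : R := if 0 <= a then 1 else -1.

(* When the slope is [a], the noise is [sgn a * sigma ^+ 2 / noise a] with
   probability [prob a] and [- sgn a * noise a] otherwise: it has mean [0] and
   variance [sigma ^+ 2], and the second outcome reverses the direction of the
   step since [noise a > `|a|]. *)
Definition noise a : R := `|a| + (sigma - eps).
Definition prob a : R := noise a ^+ 2 / (noise a ^+ 2 + sigma ^+ 2).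
Definition slope_toward a : R := sgn a * (`|a| + sigma ^+ 2 / noise a).
Definition slope_away a : R := sgn a * - (sigma - eps).

(** The sample law may not depend on the query point; comparing one uniform sample with a threshold
    that varies with [x] still yields every required probability. *)
Definition toward x (z : R) : bool := z <= prob (h * x ord0 ord0).
Definition oracle x (z : R) : 'rV[R]_1 :=
  const_mx (if toward x z then slope_toward (h * x ord0 ord0)
            else slope_away (h * x ord0 ord0)).

Lemma mulr_sgn a : sgn a * `|a| = a.
Proof.
rewrite /sgn; case: leP => a0; first by rewrite mul1r ger0_norm.
by rewrite mulN1r ltr0_norm// opprK.
Qed.

Lemma normr_sgn a : `|sgn a| = 1.
Proof. by rewrite /sgn; case: ifP; rewrite ?normrN normr1. Qed.

Lemma sgn_sqr a : sgn a ^+ 2 = 1.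
Proof. by rewrite -real_normK ?num_real// normr_sgn expr1n. Qed.

(** Multiplying by [sgn a] keeps the absolute value and turns the argument into [|a| + b]. Negative
    [b] is allowed: a step that overshoots the minimizer only helps the lower bound. *)
Lemma normrD_sgn a b : `|a| + b <= `|a + b * sgn a|.
Proof.
have -> : `|a + b * sgn a| = `|sgn a * (a + b * sgn a)|.
  by rewrite normrM normr_sgn mul1r.
have sa : sgn a * a = `|a|.
  by rewrite -{2}[a]mulr_sgn mulrA -expr2 sgn_sqr mul1r.
by rewrite (le_trans _ (ler_norm _))// mulrDr sa mulrCA -expr2 sgn_sqr mulr1.
Qed.

Lemma noise_gt0 a : 0 < noise a.
Proof. by rewrite ltr_wpDl ?normr_ge0// subr_gt0. Qed.

Lemma noise_den_gt0 a : 0 < noise a ^+ 2 + sigma ^+ 2.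
Proof. by rewrite addr_gt0 ?exprn_gt0 ?noise_gt0. Qed.

Lemma prob_itv a : 0 <= prob a <= 1.
Proof.
rewrite divr_ge0 ?sqr_ge0 ?(ltW (noise_den_gt0 a))//=.
by rewrite ler_pdivrMr ?noise_den_gt0// mul1r lerDl sqr_ge0.
Qed.

(* AM-GM: [2 * noise a * sigma <= noise a ^+ 2 + sigma ^+ 2]. *)
Lemma prob_drift a : (eps - `|a|) / sigma <= 1 - 2 * prob a.
Proof.
have sn := noise_den_gt0 a.
have -> : (eps - `|a|) / sigma = 1 - noise a / sigma.
  by rewrite /noise; field; rewrite gt_eqF.
rewrite lerD2l lerN2 /prob mulrA ler_pdivrMr// mulrAC ler_pdivlMr// -subr_ge0.
rewrite [leRHS](_ : _ = noise a * (noise a - sigma) ^+ 2); last by ring.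
by rewrite mulr_ge0 ?sqr_ge0 ?(ltW (noise_gt0 a)).
Qed.

(** With [v = noise a], the deviations [sigma ^+ 2 / v] and [- v] (times [sgn a]) have weights
    proportional to [v ^+ 2] and [sigma ^+ 2], so they cancel. *)
Lemma mean_slope a : prob a * slope_toward a + (1 - prob a) * slope_away a = a.
Proof.
rewrite -[RHS]mulr_sgn /prob /slope_toward /slope_away.
have := noise_den_gt0 a; have := noise_gt0 a.
(* Eliminating [eps] lets [field] treat [noise a] as an atom. *)
have -> : sigma - eps = noise a - `|a| by rewrite /noise; ring.
by move=> /gt_eqF n0 /gt_eqF d0; field; rewrite n0 d0.
Qed.

Lemma var_slope a :
  prob a * (slope_toward a - a) ^+ 2 + (1 - prob a) * (slope_away a - a) ^+ 2 =
  sigma ^+ 2.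
Proof.
rewrite -{3 6}[a]mulr_sgn /prob /slope_toward /slope_away -!mulrBr !exprMn sgn_sqr.
have := noise_den_gt0 a; have := noise_gt0 a.
have -> : sigma - eps = noise a - `|a| by rewrite /noise; ring.
by move=> /gt_eqF n0 /gt_eqF d0; field; rewrite n0 d0.
Qed.

(** Normalization discards the size of the sample: both outcomes move the iterate equally far in
    opposite directions, so the drift is governed by [prob a]. *)
Lemma slope_toward_dir a : slope_toward a / `|slope_toward a| = sgn a.
Proof.
have w0 : 0 < `|a| + sigma ^+ 2 / noise a.
  by rewrite ltr_wpDl// divr_gt0 ?exprn_gt0 ?noise_gt0.
by rewrite /slope_toward normrM normr_sgn mul1r gtr0_norm// mulfK// gt_eqF.
Qed.

Lemma slope_away_dir a : slope_away a / `|slope_away a| = - sgn a.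
Proof.
have w0 : 0 < sigma - eps by rewrite subr_gt0.
rewrite /slope_away normrM normr_sgn mul1r normrN gtr0_norm// mulrN mulNr.
by rewrite mulfK// gt_eqF.
Qed.

Lemma measurable_noise : measurable_fun [set: R] noise.
Proof. by apply: measurable_funD => //; exact: normr_measurable. Qed.

(** On positive values inversion is [expR (- ln _)], a composition of measurable maps. *)
Lemma measurable_inv_pos (f : R -> R) : measurable_fun [set: R] f ->
  (forall a, 0 < f a) -> measurable_fun [set: R] (fun a => (f a)^-1).
Proof.
move=> mf f0.
have -> : (fun a => (f a)^-1) = (fun a => expR (- ln (f a))).
  by apply/funext => a; rewrite expRN lnK// posrE.
apply: measurableT_comp => //; apply: measurableT_comp => //.
exact: measurableT_comp.
Qed.

Lemma measurable_prob : measurable_fun [set: R] prob.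
Proof.
have mn := measurable_noise.
apply: measurable_funM; first exact: measurable_funX.
apply: measurable_inv_pos => [|a]; last exact: noise_den_gt0.
by apply: measurable_funD => //; exact: measurable_funX.
Qed.

Lemma measurable_sgn : measurable_fun [set: R] sgn.
Proof. by apply: measurable_fun_ifT => //; exact: measurable_fun_ler. Qed.

Lemma measurable_slope_toward : measurable_fun [set: R] slope_toward.
Proof.
apply: measurable_funM; first exact: measurable_sgn.
apply: measurable_funD; first exact: normr_measurable.
apply: measurable_funM => //; apply: measurable_inv_pos noise_gt0.
exact: measurable_noise.
Qed.

Lemma measurable_slope_away : measurable_fun [set: R] slope_away.
Proof. by apply: measurable_funM => //; exact: measurable_sgn. Qed.

Lemma measurable_oracle :
  measurable_fun [set: borel_rV R 1 * R] (fun p => oracle p.1 p.2 : borel_rV R 1).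
Proof.
have ma : measurable_fun [set: borel_rV R 1 * R]
    (fun p => h * (p.1 : 'rV[R]_1) ord0 ord0).
  apply: measurable_funM => //; apply: (measurableT_comp measurable_coord_rV1).
  exact: measurable_fst.
apply: (measurableT_comp measurable_const_rV1).
apply: measurable_fun_ifT.
- apply: measurable_fun_ler; first exact: measurable_snd.
  exact: (measurableT_comp measurable_prob).
- exact: (measurableT_comp measurable_slope_toward).
- exact: (measurableT_comp measurable_slope_away).
Qed.

Lemma measurable_toward x : measurable_fun [set: R] (toward x).
Proof. exact: measurable_fun_ler. Qed.

Lemma uniform_prob_toward x :
  uniform_prob (@ltr01 R) (toward x @^-1` [set true]) =
  (prob (h * x ord0 ord0))%:E.
Proof. by rewrite -uniform_prob01_le ?prob_itv. Qed.

Lemma stochastic_gradient_oracle :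
  stochastic_gradient (quad h) (uniform_prob (@ltr01 R)) oracle sigma.
Proof.
split.
- exact: measurable_oracle.
- move=> x i; under eq_fun do rewrite mxE.
  apply: integrable_two_valued; exact: measurable_toward.
- move=> x i; under eq_fun do rewrite mxE.
  rewrite (expectation_two_valued _ _ _ (uniform_prob_toward x)).
    by rewrite mean_slope gradient_quad mxE (ord1 i).
  exact: measurable_toward.
- move=> x; set a := h * x ord0 ord0.
  rewrite [X in ('E_ _[X])%E](_ : _ = fun z => if toward x z then
      (slope_toward a - a) ^+ 2 else (slope_away a - a) ^+ 2); last first.
    apply/funext => z; rewrite enorm_rV1 real_normK ?num_real//.
    by rewrite gradient_quad !mxE; case: ifP.
  rewrite (expectation_two_valued _ _ _ (uniform_prob_toward x)).
    by rewrite var_slope.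
  exact: measurable_toward.
Qed.

End oracle.

(** * The hard instance and its potential *)

Theorem theorem3 (R : realType) (l sigma eps Delta gamma_max : R)
    (gamma : nat -> R)
    (l_gt0 : 0 < l) (sigma_gt0 : 0 < sigma) (eps_gt0 : 0 < eps)
    (Delta_gt0 : 0 < Delta)
    (gamma_gt0 : forall t, 0 < gamma t)
    (gamma_le : forall t, gamma t <= gamma_max)
    (eps_small : eps ^+ 2 <
      Num.min (sigma ^+ 2)
        (Num.min (2 * l * Delta) (2 * Delta * (sigma - eps) / gamma_max))) :
  exists (n : nat) (f : 'rV[R]_n -> R) (x0 : 'rV[R]_n)
    (dXi : measure_display) (Xi : measurableType dXi) (D : probability Xi R)
    (g : 'rV[R]_n -> Xi -> 'rV[R]_n),
    [/\ smooth l f,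
        convex_function [set: convex_lmodType 'rV[R]_n] f,
        suboptimality_le f x0 Delta,
        stochastic_gradient f D g sigma &
        forall (dOmega : measure_display) (Omega : measurableType dOmega)
          (P : probability Omega R) (xi : nat -> {RV P >-> Xi}),
          iid D xi ->
          forall t : nat,
            (eps%:E <=
             'E_P[fun w => enorm (gradient f (nsgd gamma g x0 (xi ^~ w) t))])%E].
Proof.
move: eps_small; rewrite !lt_min => /and3P[].
rewrite ltr_pXn2r ?nnegrE ?(ltW eps_gt0) ?(ltW sigma_gt0)// => eps_sigma eps_l.
have gmax_gt0 : 0 < gamma_max := lt_le_trans (gamma_gt0 0%N) (gamma_le 0%N).
rewrite ltr_pdivlMr// => eps_gamma.
(* Starting at slope [eps], that is at [eps / h], costs a gap of [eps ^+ 2 / (2 * h)]; this [h]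
   makes it exactly [Delta]. *)
pose h := eps ^+ 2 / (2 * Delta).
have h_gt0 : 0 < h by rewrite divr_gt0 ?exprn_gt0 ?mulr_gt0.
have hl : h <= l by rewrite ler_pdivrMr ?mulr_gt0// mulrCA mulrA ltW.
(* The third bound on [eps ^+ 2] yields [h * gamma_max <= sigma - eps], which is at most [sigma]. *)
have hgamma s : h * gamma s <= sigma.
  rewrite (le_trans (ler_wpM2l (ltW h_gt0) (gamma_le s)))//.
  rewrite mulrAC ler_pdivrMr ?mulr_gt0// (le_trans (ltW eps_gamma))// mulrC.
  by rewrite ler_wpM2r ?mulr_ge0 ?(ltW Delta_gt0)// gerBl ltW.
pose x0 : 'rV[R]_1 := const_mx (eps / h).
exists 1%N, (quad h), x0, _, _, (uniform_prob (@ltr01 R)), (oracle h sigma eps).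
split.
- exact: smooth_quad (ltW h_gt0) hl.
- exact: convex_quad (ltW h_gt0).
- exists 0 => [x|]; rewrite /quad !mxE expr0n mulr0.
    by rewrite mulr_ge0 ?sqr_ge0// divr_ge0// ltW.
  rewrite subr0 /h le_eqVlt; apply/orP; left; apply/eqP; field.
  by rewrite !gt_eqF.
- exact: stochastic_gradient_oracle.
move=> dOmega Omega P xi xi_iid T.
(* The value at time [T] of the affine recursion whose excess over [eps] is multiplied by
   [1 - h * gamma i / sigma] at each step, started at time [s] from the slope size at [x]. At [x0]
   the excess is zero. *)
pose V s (x : 'rV[R]_1) : R :=
  eps + \prod_(s <= i < T) (1 - h * gamma i / sigma) * (`|h * x ord0 ord0| - eps).
have VT0 : V 0%N x0 = eps.
  by rewrite /V mxE [h * _]mulrC divfK ?gt_eqF// gtr0_norm// subrr mulr0 addr0.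
rewrite -[X in X%:E]VT0.
apply: (nsgd_lower_bound xi_iid (c := toward h sigma eps)
  (g1 := fun x => const_mx (slope_toward sigma eps (h * x ord0 ord0)))
  (g2 := fun x => const_mx (slope_away sigma eps (h * x ord0 ord0)))
  (p := fun x => prob sigma eps (h * x ord0 ord0))
  (F := fun x => enorm (gradient (quad h) x))).
- exact: measurable_toward.
- by move=> x z; rewrite /oracle; case: ifP.
- by move=> x; exact: uniform_prob_toward.
- by move=> x; exact: sqrtr_ge0.
- by move=> x; rewrite /V big_geq// mul1r addrC subrK gradient_quad enorm_rV1 mxE.
move=> s x sT; rewrite /V [in leLHS]big_ltn// !enorm_rV1 !mxE.
set a := h * x ord0 ord0; set q := \prod_(_ <= i < _) _.
(* Here [h * gamma i <= sigma] enters: the later factors are nonnegative, so the potential is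
   nondecreasing in the slope size. *)
have q_ge0 : 0 <= q.
  apply: prodr_ge0 => i _.
  by rewrite subr_ge0 ler_pdivrMr// mul1r.
have := @prob_drift _ sigma eps sigma_gt0 eps_sigma a.
have := @prob_itv _ sigma eps sigma_gt0 eps_sigma a.
set p := prob _ _ _ => /andP[p0 p1] drift.
(* Regrouping exposes the unit directions, so the two new slopes become [a] minus or plus
   [h * gamma s * sgn a]. *)
rewrite ![gamma s / _ * _]mulrAC -![gamma s * _ / _]mulrA slope_toward_dir// slope_away_dir//.
rewrite ![h * (_ - _)]mulrBr -/a !mulrN opprK !mulrA.
have a1E := normrD_sgn a (- (h * gamma s)); have a2E := normrD_sgn a (h * gamma s).
rewrite mulNr in a1E.
set a1 := `|a - _| in a1E *; set a2 := `|a + _| in a2E *.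
pose e := h * gamma s; rewrite -/e in a1E a2E *.
have e0 : 0 <= e by rewrite mulr_ge0 ?(ltW h_gt0) ?(ltW (gamma_gt0 s)).
(* The middle term is the average of the potential when the slope size becomes [|a| - e] with weight
   [p] and [|a| + e] otherwise. The drift bound puts it above the left side; [a1E] and [a2E],
   weighted by [p] and [1 - p], put it below the right side. *)
apply: (@le_trans _ _ (eps + q * (`|a| - eps + e * (1 - 2 * p)))).
  rewrite lerD2l [X in X <= _]mulrAC mulrC [X in _ * X](_ : _ =
    `|a| - eps + e * ((eps - `|a|) / sigma)).
    by rewrite ler_wpM2l// lerD2l ler_wpM2l.
  by field; rewrite gt_eqF.
have : p * (eps + q * (`|a| - e - eps)) <= p * (eps + q * (a1 - eps)).
  by rewrite ler_wpM2l// lerD2l ler_wpM2l// lerD2r.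
have : (1 - p) * (eps + q * (`|a| + e - eps)) <= (1 - p) * (eps + q * (a2 - eps)).
  by rewrite ler_wpM2l ?subr_ge0// lerD2l ler_wpM2l// lerD2r.
lra.
Qed.
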